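(* For $\eta>k^2$ and $k^2<\bar\alpha$, the preconditioned matrix $\mathcal{P}^{-1}\mathcal{K}$ is self-adjoint and positive definite with respect to the inner product on $\mathbb{R}^{n+m}$ $$\langle x,y\rangle=x^T\begin{pmatrix} A+\eta M-k^2M & 0\\ 0 & I\end{pmatrix}y .$$
   Context: Let $m\le n$ and let $k$, $\eta$ be real numbers. $A\in\mathbb{R}^{n\times n}$ is symmetric positive semidefinite with $\dim\ker(A)=m$; $M\in\mathbb{R}^{n\times n}$ is symmetric positive definite; $B\in\mathbb{R}^{m\times n}$ has full row rank; $C\in\mathbb{R}^{n\times m}$ is a matrix whose columns form a basis of $\ker(A)$ (so $AC=0$) and satisfies $MC=B^T$; and $L=BC\in\mathbb{R}^{m\times m}$ (so $L=C^TMC$ is symmetric positive definite). Then $\mathbb{R}^n=\ker(A)\oplus\ker(B)$. The saddle-point matrix is $\mathcal{K}=\begin{pmatrix} A-k^2M & B^T\\ B & 0\end{pmatrix}$; standing assumption: both $\mathcal{K}$ and $A-k^2M$ are nonsingular. $\bar\alpha>0$ is a constant such that $u^TAu\ge\bar\alpha\,u^TMu$ for all $u\in\ker(B)$. For $\eta>k^2$ the preconditioner is defined through $$\mathcal{P}^{-1}=\begin{pmatrix}(A+\eta M-k^2M)^{-1}(I-B^TL^{-1}C^T) & CL^{-1}\\ L^{-1}C^T & k^2L^{-1}\end{pmatrix}.$$ A matrix $G$ is self-adjoint and positive definite with respect to $\langle\cdot,\cdot\rangle$ if $\langle Gx,y\rangle=\langle x,Gy\rangle$ for all $x,y$ and $\langle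 Gx,x\rangle>0$ for all $x\ne0$. *)

(* Defs.v *)
From HB Require Import structures.
From mathcomp Require Import all_boot all_order all_algebra.
From mathcomp Require Import reals.

Set Implicit Arguments.
Unset Strict Implicit.
Unset Printing Implicit Defensive.

Import Order.TTheory GRing.Theory Num.Theory.
Local Open Scope ring_scope.

Section Forms.
Variables (R : realType) (p : nat).

Definition bilin (G : 'M[R]_p) (x y : 'cV[R]_p) : R := (x^T *m G *m y) 0 0.

Definition sym_psd (G : 'M[R]_p) : Prop :=
  G^T = G /\ forall x : 'cV[R]_p, 0 <= bilin G x x.

Definition sym_pd (G : 'M[R]_p) : Prop :=
  G^T = G /\ forall x : 'cV[R]_p, x != 0 -> 0 < bilin G x x.

Definition inner_product (ip : 'cV[R]_p -> 'cV[R]_p -> R) : Prop :=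
  [/\ forall (a : R) (x y z : 'cV[R]_p), ip (a *: x + y) z = a * ip x z + ip y z,
      forall x y : 'cV[R]_p, ip x y = ip y x
    & forall x : 'cV[R]_p, x != 0 -> 0 < ip x x].

Definition self_adjoint (ip : 'cV[R]_p -> 'cV[R]_p -> R) (G : 'M[R]_p) : Prop :=
  forall x y : 'cV[R]_p, ip (G *m x) y = ip x (G *m y).

Definition pos_def (ip : 'cV[R]_p -> 'cV[R]_p -> R) (G : 'M[R]_p) : Prop :=
  forall x : 'cV[R]_p, x != 0 -> 0 < ip (G *m x) x.

End Forms.

Section Kernel.
Variable R : realType.

(* [kermx] is the left kernel, so the rows of [kermx A^T] span the
   transposes of the vectors x with A *m x = 0. *)
Definition rkermx (p n : nat) (A : 'M[R]_(p, n)) : 'M[R]_n := kermx A^T.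

Definition columns_basis_of_ker (p n m : nat)
    (A : 'M[R]_(p, n)) (C : 'M[R]_(n, m)) : Prop :=
  row_free C^T /\ (C^T == rkermx A)%MS.

End Kernel.

Section SaddlePoint.
Variables (R : realType) (m n : nat).
Variables (A M : 'M[R]_n) (B : 'M[R]_(m, n)) (C : 'M[R]_(n, m)) (k eta : R).

Definition saddle_mx : 'M[R]_(n + m) :=
  block_mx (A - k ^+ 2 *: M) B^T B 0.

Definition shifted_mx : 'M[R]_n := A + eta *: M - k ^+ 2 *: M.

(* This is P^-1 itself, not P.  [invmx] is the identity on singular matrices;
   the inverses of [shifted_mx] and [L] are genuine when A is positive
   semidefinite, M positive definite, k ^+ 2 < eta, M *m C = B^T and the columns
   of C are linearly independent. *)
Definition precond_inv : 'M[R]_(n + m) :=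
  let L := B *m C in
  block_mx
    (invmx shifted_mx *m (1%:M - B^T *m invmx L *m C^T)) (C *m invmx L)
    (invmx L *m C^T)                                     (k ^+ 2 *: invmx L).

Definition precond_ip : 'cV[R]_(n + m) -> 'cV[R]_(n + m) -> R :=
  bilin (block_mx shifted_mx 0 0 1%:M).

End SaddlePoint.

(* Main.v *)
(** The inner-product matrix is [W = diag (S, I)] with
    [S = A + eta M - k^2 M].  From [A C = 0] and [M C = B^T] one gets
    [C^T (A - k^2 M) = - k^2 B] and [S C = (eta - k^2) B^T], and with these
    [W P^-1 K = diag (A - k^2 M + eta B^T L^-1 B, I)], which is symmetric.  For
    definiteness write [x = u + C w] with [w = L^-1 B x], so that [B u = 0].
    The vectors [u] and [C w] are [M]-orthogonal, whence
    [x^T (A - k^2 M + eta B^T L^-1 B) x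
       = u^T A u - k^2 u^T M u + (eta - k^2) (C w)^T M (C w)]. *)
Require Import Defs.
From mathcomp Require Import all_boot all_order all_algebra.
From mathcomp Require Import reals.
From mathcomp Require Import lra.
Import Order.TTheory GRing.Theory Num.Theory.
Local Open Scope ring_scope.

(** * Bilinear forms given by matrices *)

Section BilinearForms.
Variables (R : realType) (p : nat).
Implicit Types (F G W : 'M[R]_p) (x y z : 'cV[R]_p).

Lemma bilin_Dl G x y z : bilin G (x + y) z = bilin G x z + bilin G y z.
Proof. by rewrite /bilin linearD /= !mulmxDl mxE. Qed.

Lemma bilin_Zl a G x z : bilin G (a *: x) z = a * bilin G x z.
Proof. by rewrite /bilin linearZ /= -!scalemxAl mxE. Qed.

Lemma bilinDm F G x y : bilin (F + G) x y = bilin F x y + bilin G x y.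
Proof. by rewrite /bilin mulmxDr mulmxDl mxE. Qed.

Lemma bilinZm a G x y : bilin (a *: G) x y = a * bilin G x y.
Proof. by rewrite /bilin -scalemxAr -scalemxAl mxE. Qed.

Lemma bilin0l G y : bilin G 0 y = 0.
Proof. by rewrite /bilin trmx0 !mul0mx mxE. Qed.

Lemma bilin_trmx G x y : bilin G^T x y = bilin G y x.
Proof.
by rewrite /bilin -(trmxK y) -!trmx_mul mulmxA trmxK mxE.
Qed.

Lemma bilin_mull W G x y : bilin W (G *m x) y = bilin (G^T *m W) x y.
Proof. by rewrite /bilin trmx_mul !mulmxA. Qed.

Lemma bilin_mulr W G x y : bilin W x (G *m y) = bilin (W *m G) x y.
Proof. by rewrite /bilin !mulmxA. Qed.

Lemma bilinDD_orthogonal G x y :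
  G^T = G -> bilin G x y = 0 ->
  bilin G (x + y) (x + y) = bilin G x x + bilin G y y.
Proof.
move=> Gsym xy0; have yx0 : bilin G y x = 0 by rewrite -bilin_trmx Gsym.
rewrite bilin_Dl -[bilin G x _]bilin_trmx -[bilin G y _]bilin_trmx Gsym.
by rewrite !bilin_Dl xy0 yx0 addr0 add0r.
Qed.

Lemma sym_pd_ge0 G x : sym_pd G -> 0 <= bilin G x x.
Proof.
case=> _ Gpos; have [->|/Gpos/ltW //] := eqVneq x 0.
by rewrite bilin0l.
Qed.

(** If [v *m G = 0] for a row [v], the form of [G] vanishes at [v^T], so [v = 0]: the left kernel is
    trivial. *)
Lemma sym_pd_unitmx G : sym_pd G -> G \in unitmx.
Proof.
case=> _ Gpos; rewrite -row_free_unit -kermx_eq0.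
apply/eqP/row_matrixP => i; rewrite row0; apply/eqP.
set v := row i _; apply/negPn/negP => v0.
have vG : v *m G = 0 by apply/sub_kermxP; rewrite row_sub.
have : 0 < bilin G v^T v^T by apply: Gpos; rewrite trmx_eq0.
by rewrite /bilin trmxK vG mul0mx mxE ltxx.
Qed.

Lemma sym_pd_inner_product G : sym_pd G -> inner_product (bilin G).
Proof.
move=> [Gsym Gpos]; split => //.
- by move=> a x y z; rewrite bilin_Dl bilin_Zl.
- by move=> x y; rewrite -bilin_trmx Gsym.
Qed.

(** Moving [G] across the form turns [W] into [G^T *m W] on the left and [W *m G] on the right.
    These are transposes of each other, so everything reduces to the single matrix [W *m G]. *)
Lemma self_adjoint_pos_def W G :
  W^T = W -> sym_pd (W *m G) ->
  self_adjoint (bilin W) G /\ pos_def (bilin W) G.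
Proof.
move=> Wsym [WGsym WGpos].
have GW : G^T *m W = W *m G by rewrite -{1}Wsym -trmx_mul.
by split=> [x y|x x0]; rewrite bilin_mull GW ?bilin_mulr //; exact: WGpos.
Qed.

End BilinearForms.

Lemma sym_pd_block_diag (R : realType) (p q : nat) (F : 'M[R]_p) (G : 'M[R]_q) :
  sym_pd F -> sym_pd G -> sym_pd (block_mx F 0 0 G).
Proof.
move=> Fpd Gpd; have [[Fsym Fpos] [Gsym Gpos]] := (Fpd, Gpd).
split=> [|x]; first by rewrite tr_block_mx !trmx0 Fsym Gsym.
rewrite -[x]vsubmxK; set u := usubmx x; set v := dsubmx x.
have -> : bilin (block_mx F 0 0 G) (col_mx u v) (col_mx u v)
          = bilin F u u + bilin G v v.
  by rewrite /bilin tr_col_mx mul_row_block !mulmx0 addr0 add0r mul_row_col mxE.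
rewrite col_mx_eq0 negb_and => /orP[/Fpos u0|/Gpos v0].
- by rewrite ltr_pwDl // sym_pd_ge0.
- by rewrite ltr_wpDl // sym_pd_ge0.
Qed.

Lemma sym_pd_1 (R : realType) (p : nat) : sym_pd (1%:M : 'M[R]_p).
Proof.
split=> [|x x0]; first exact: trmx1.
rewrite /bilin mulmx1 mxE lt_def sumr_ge0 ?andbT; last first.
  by move=> i _; rewrite mxE -expr2 sqr_ge0.
apply: contra x0 => /eqP sum0; apply/eqP/matrixP => i j; rewrite ord1 mxE.
have sq_ge0 l : true -> 0 <= x^T 0 l * x l 0 by rewrite mxE -expr2 sqr_ge0.
have /eqP : x^T 0 i * x i 0 = 0 by apply: (psumr_eq0P sq_ge0 sum0).
by rewrite mxE mulf_eq0 orbb => /eqP.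
Qed.

Lemma columns_basis_of_ker_mul (R : realType) (p n m : nat)
    (A : 'M[R]_(p, n)) (C : 'M[R]_(n, m)) :
  columns_basis_of_ker A C -> A *m C = 0.
Proof.
case=> _ /andP[/sub_kermxP CA _].
by apply: trmx_inj; rewrite trmx_mul CA trmx0.
Qed.

(** * The preconditioned saddle-point matrix *)

Section SaddlePoint.
Variables (R : realType) (m n : nat) (k eta alpha : R).
Variables (A M : 'M[R]_n) (B : 'M[R]_(m, n)) (C : 'M[R]_(n, m)).
Hypotheses (hA : sym_psd A) (hM : sym_pd M).
Hypotheses (C_free : row_free C^T) (AC : A *m C = 0) (MC : M *m C = B^T).
Hypothesis (eta_gt : k ^+ 2 < eta).

Let H := A - k ^+ 2 *: M.
Let L := B *m C.
Let S := shifted_mx A M k eta.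

Lemma sym_pd_shifted_mx : sym_pd S.
Proof.
have [[Asym Apos] [Msym Mpos]] := (hA, hM).
have -> : S = A + (eta - k ^+ 2) *: M by rewrite scalerBl addrA.
split=> [|x x0]; first by rewrite linearD linearZ /= Asym Msym.
rewrite bilinDm bilinZm ltr_wpDl ?Apos //.
by rewrite mulr_gt0 ?Mpos // subr_gt0.
Qed.

Let CM : C^T *m M = B.
Proof. by rewrite -[RHS]trmxK -MC trmx_mul hM.1. Qed.

Let CA : C^T *m A = 0.
Proof. by rewrite -hA.1 -trmx_mul AC trmx0. Qed.

Let CB : C^T *m B^T = L.
Proof. by rewrite -MC mulmxA CM. Qed.

(** [L] equals [C^T *m M *m C], the Gram matrix for [M] of the linearly independent columns of
    [C]. *)
Lemma sym_pd_BC : sym_pd L.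
Proof.
split=> [|w w0]; first by rewrite trmx_mul CB.
have -> : bilin L w w = bilin M (C *m w) (C *m w).
  by rewrite /bilin trmx_mul -!mulmxA (mulmxA M) (mulmxA C^T) MC CB !mulmxA.
apply: hM.2; apply: contra w0 => /eqP Cw.
rewrite -trmx_eq0 -(mulmx_free_eq0 _ C_free).
by rewrite -trmx_mul Cw trmx0.
Qed.

Let L_unit : L \in unitmx.
Proof. exact: sym_pd_unitmx sym_pd_BC. Qed.

Let CH : C^T *m H = - (k ^+ 2 *: B).
Proof. by rewrite mulmxBr CA -scalemxAr CM sub0r. Qed.

Let SC : S *m C = (eta - k ^+ 2) *: B^T.
Proof.
by rewrite mulmxBl mulmxDl AC -!scalemxAl MC add0r scalerBl.
Qed.

Lemma ip_precond_saddle_mx :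
  block_mx S 0 0 1%:M *m (precond_inv A M B C k eta *m saddle_mx A M B k)
  = block_mx (H + eta *: (B^T *m invmx L *m B)) 0 0 1%:M.
Proof.
have S_unit : S \in unitmx := sym_pd_unitmx _ _ _ sym_pd_shifted_mx.
rewrite mulmxA /precond_inv /saddle_mx -/L -/H -/S.
rewrite mulmx_block !mul0mx !mul1mx !addr0 !add0r.
rewrite !mulmxA (mulmxV S_unit) mul1mx SC.
rewrite mulmx_block !mulmx0 !addr0.
congr block_mx.
(* Upper left: by [CH], the term [- B^T L^-1 C^T H] becomes [k^2 B^T L^-1 B], which raises the
   coefficient [eta - k^2] coming from [SC] to [eta]. *)
- rewrite mulmxBl mul1mx -!mulmxA CH !mulmxN -!scalemxAl -!scalemxAr !mulmxA.
  by rewrite opprK -addrA -scalerDl subrKC.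
(* Upper right: [I - B^T L^-1 C^T] annihilates [B^T], since [C^T B^T = L]. *)
- by rewrite mulmxBl mul1mx -!mulmxA CB mulVmx // mulmx1 subrr.
(* Lower left: the block [k^2 L^-1] of the preconditioner is what cancels
   [L^-1 C^T H = - k^2 L^-1 B]. *)
- by rewrite -mulmxA CH mulmxN -scalemxAr -scalemxAl addNr.
- by rewrite -mulmxA CB mulVmx.
Qed.

Hypothesis coercive :
  forall u : 'cV[R]_n, B *m u = 0 -> alpha * bilin M u u <= bilin A u u.
Hypothesis k_lt : k ^+ 2 < alpha.

Lemma sym_pd_reduced_block : sym_pd (H + eta *: (B^T *m invmx L *m B)).
Proof.
have Lsym := sym_pd_BC.1.
split=> [|x x0].
  rewrite linearD linearB /= !linearZ /= !trmx_mul trmxK hA.1 hM.1.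
  by rewrite trmx_inv Lsym mulmxA scalerN.
(* [v] is the projection of [x] onto the kernel of [A] along the kernel of [B]. *)
set w := invmx L *m (B *m x).
set v := C *m w.
set u := x - v.
have xE : x = u + v by rewrite subrK.
have Bv : B *m v = B *m x by rewrite /v /w !mulmxA mulmxV // mul1mx.
have Bu : B *m u = 0 by rewrite mulmxBr Bv subrr.
have Av y : bilin A y v = 0.
  by rewrite /bilin -mulmxA /v (mulmxA A) AC mul0mx mulmx0 mxE.
(* Because [M C = B^T], pairing [u] with [C w] through [M] amounts to pairing [B u = 0] with [w]. *)
have Muv : bilin M u v = 0.
  rewrite /bilin -mulmxA /v (mulmxA M) MC mulmxA -trmx_mul Bu.
  by rewrite trmx0 mul0mx mxE.
have Ax : bilin A x x = bilin A u u.
  by rewrite xE bilinDD_orthogonal ?Av ?addr0 //; exact: hA.1.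
have Mx : bilin M x x = bilin M u u + bilin M v v.
  by rewrite xE bilinDD_orthogonal //; exact: hM.1.
(* Since [B x = L w], both sides equal [w^T L w]. *)
have BLBx : bilin (B^T *m invmx L *m B) x x = bilin M v v.
  rewrite /bilin /v trmx_mul -!mulmxA (mulmxA M) MC (mulmxA C^T) CB.
  rewrite /w mulKVmx // trmx_mul trmx_inv Lsym trmx_mul.
  by rewrite !mulmxA.
rewrite bilinDm bilinZm BLBx /H bilinDm -scaleNr bilinZm Ax Mx.
have Auu := coercive u Bu.
have Mu_ge0 := sym_pd_ge0 _ _ _ u hM.
have Mv_ge0 := sym_pd_ge0 _ _ _ v hM.
have Muv_gt0 : 0 < bilin M u u + bilin M v v by rewrite -Mx; exact: hM.2.
have ak_u : 0 <= (alpha - k ^+ 2) * bilin M u u by rewrite mulr_ge0 // subr_ge0 ltW.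
have ek_v : 0 <= (eta - k ^+ 2) * bilin M v v by rewrite mulr_ge0 // subr_ge0 ltW.
(* By coercivity the form is at least [(alpha - k^2) u^T M u + (eta - k^2) v^T M v]. Both terms are
   nonnegative; when the first vanishes, [x != 0] forces the second to be positive. *)
have [u0|u_gt0] := leP (bilin M u u) 0.
- have : 0 < (eta - k ^+ 2) * bilin M v v.
    by rewrite mulr_gt0 ?subr_gt0 //; lra.
  lra.
- have : 0 < (alpha - k ^+ 2) * bilin M u u by rewrite mulr_gt0 ?subr_gt0.
  lra.
Qed.

End SaddlePoint.

Theorem mainTheorem5 (R : realType) (m n : nat) (k eta alpha : R)
    (A M : 'M[R]_n) (B : 'M[R]_(m, n)) (C : 'M[R]_(n, m))
    (le_mn : (m <= n)%N)
    (hA : sym_psd A)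
    (dim_kerA : \rank (rkermx A) = m)
    (hM : sym_pd M)
    (hB : row_free B)
    (hC : columns_basis_of_ker A C)
    (hMC : M *m C = B^T)
    (hK : saddle_mx A M B k \in unitmx)
    (hAkM : A - k ^+ 2 *: M \in unitmx)
    (alpha_gt0 : 0 < alpha)
    (coercive : forall u : 'cV[R]_n, B *m u = 0 -> alpha * bilin M u u <= bilin A u u)
    (eta_gt : k ^+ 2 < eta)
    (k_lt : k ^+ 2 < alpha) :
  inner_product (precond_ip (m := m) A M k eta) /\
  self_adjoint (precond_ip A M k eta)
    (precond_inv A M B C k eta *m saddle_mx A M B k) /\
  pos_def (precond_ip A M k eta)
    (precond_inv A M B C k eta *m saddle_mx A M B k).
Proof.
have AC := columns_basis_of_ker_mul _ _ _ _ _ _ hC.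
have Wpd : sym_pd (block_mx (shifted_mx A M k eta) 0 0 (1%:M : 'M_m)).
  by apply: sym_pd_block_diag; [exact: sym_pd_shifted_mx | exact: sym_pd_1].
split; first exact: sym_pd_inner_product.
apply: self_adjoint_pos_def; first exact: Wpd.1.
rewrite ip_precond_saddle_mx //; last exact: hC.1.
apply: sym_pd_block_diag; last exact: sym_pd_1.
by apply: (sym_pd_reduced_block _ _ _ _ _ alpha) => //; exact: hC.1.
Qed.
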